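(* Let $a\ge 0$. The function $t\mapsto f_{\nu,a}(t)$ is log-concave on $(0,\infty)$ for all $\nu\ge 1/2$ if and only if $0\le a\le 1$.
   Context: For $\mu>-1$ and $t>0$, the modified Bessel function of the first kind is $I_\mu(t)=\sum_{k=0}^\infty \frac{(t/2)^{2k+\mu}}{k!\,\Gamma(\mu+k+1)}$. For $\nu>0$, $a\ge 0$ and $t>0$, $f_{\nu,a}$ denotes the integrand in the definition $Q_\nu(a,b)=\int_b^\infty f_{\nu,a}(t)\,dt$ of the generalized Marcum Q function: $$f_{\nu,a}(t)=\frac{t^\nu}{a^{\nu-1}}\exp\left(-\frac{t^2+a^2}{2}\right)I_{\nu-1}(at),$$ where for $a=0$ the expression is defined by the limit $a\downarrow 0$, i.e. $f_{\nu,0}(t)=\frac{t^{2\nu-1}}{2^{\nu-1}\Gamma(\nu)}e^{-t^2/2}$. A nonnegative function $g$ on an interval $J$ is log-concave if $g(\lambda x+(1-\lambda)y)\ge g(x)^\lambda g(y)^{1-\lambda}$ for all $x,y\in J$, $\lambda\in(0,1)$. *)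

(* Defs.v *)
(* Stdlib's real numbers with Coquelicot. *)
From Stdlib Require Import Reals Factorial.
From Coquelicot Require Import Coquelicot.
Open Scope R_scope.

(* Euler's integral; meaningful for x > 0, where it converges. *)
Definition Gamma (x : R) : R :=
  RInt_gen (fun t : R => Rpower t (x - 1) * exp (- t))
           (at_right 0) (Rbar_locally p_infty).

(* Meaningful for mu > -1 and t > 0, since [Rpower] is the usual power only
   for a positive base. *)
Definition BesselI (mu t : R) : R :=
  Series (fun k : nat =>
    Rpower (t / 2) (2 * INR k + mu) / (INR (fact k) * Gamma (mu + INR k + 1))).

(* The integrand of the generalized Marcum Q function of order nu, for nu > 0,
   a >= 0 and t > 0. The value at a = 0 is the limit as a tends to 0 from the
   right. *)
Definition marcum_integrand (nu a t : R) : R :=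
  if Req_EM_T a 0 then
    Rpower t (2 * nu - 1) / (Rpower 2 (nu - 1) * Gamma nu) * exp (- (t ^ 2 / 2))
  else
    Rpower t nu / Rpower a (nu - 1) * exp (- ((t ^ 2 + a ^ 2) / 2))
    * BesselI (nu - 1) (a * t).

(* Power of a nonnegative base with a positive exponent. [Rpower] alone would
   not do: it gives [Rpower 0 y = exp (y * ln 0) = 1], whereas 0 to a positive
   power is 0. *)
Definition pow_nonneg (x y : R) : R :=
  if Req_EM_T x 0 then 0 else Rpower x y.

Definition log_concave_on (J : R -> Prop) (g : R -> R) : Prop :=
  (forall x : R, J x -> 0 <= g x) /\
  (forall x y lambda : R, J x -> J y -> 0 < lambda < 1 ->
     pow_nonneg (g x) lambda * pow_nonneg (g y) (1 - lambda)
     <= g (lambda * x + (1 - lambda) * y)).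

(* Main.v *)
Require Import Defs.
From Stdlib Require Import Reals Lra Lia Factorial.
From Coquelicot Require Import Coquelicot.
Open Scope R_scope.

(** Write [Phi_nu x] for the Bessel-Clifford series
    [sum_k x^k / (k! Gamma (nu + k))]. Pulling the power of [a t] out of the Bessel
    function turns the integrand, for every [a >= 0], into
    [C * t^(2 nu - 1) * exp (- t^2 / 2) * Phi_nu ((a t)^2 / 4)]
    ([marcum_integrand_exp]), so the question is whether the logarithm of this
    product is concave.

    If [a <= 1], it is, since its second derivative is nonpositive
    ([log_marcum_concave]). The function [h z = Phi_nu (z^2 / 4)] satisfies
    [h'' + (2 nu - 1) / z * h' = h] with [h, h' > 0], hence for [nu >= 1/2]
    [(ln h)'' = h'' / h - (h' / h)^2 <= 1]; the Gaussian factor contributes [- 1] and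
    the scaling by [a] multiplies the bound on [(ln h)''] by [a^2 <= 1], while
    [(2 nu - 1) * ln t] is concave by itself. The differential equation comes from
    [Phi_nu' = Phi_(nu+1)] and [Phi_nu = nu * Phi_(nu+1) + x * Phi_(nu+2)]
    ([is_derive_bessel_clifford], [bessel_clifford_recurrence]). The latter and the
    convergence of the series rest on [Gamma (x + 1) = x * Gamma x] and on positivity
    of Gamma ([Gamma_succ], [Gamma_pos]), which are derived from Euler's integral.

    Conversely, for [nu = 1/2] the equation is [h'' = h], so the integrand is a
    multiple of [exp (- t^2 / 2) * cosh (a t)] ([bessel_clifford_half]). The second
    derivative of its logarithm tends to [a^2 - 1] as [t] tends to 0, so [a > 1] is
    excluded; [log_marcum_half_midpoint] is a form of this free of derivatives,
    obtained from the concavity inequality at the midpoint of [m - d] and [m + d]. *)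

(** * Calculus on the positive half-line *)

Lemma locally_positive (x : R) : 0 < x -> locally x (fun t : R => 0 < t).
Proof. intros Hx; exact (open_gt 0 x Hx). Qed.

Lemma mean_value_positive (F f : R -> R) :
  (forall t : R, 0 < t -> is_derive F t (f t)) ->
  forall u v : R, 0 < u -> 0 < v ->
  exists c : R, Rmin u v <= c <= Rmax u v /\ F v - F u = f c * (v - u).
Proof.
  intros HF u v Hu Hv.
  assert (Hm : 0 < Rmin u v) by now apply Rmin_glb_lt.
  apply MVT_gen.
  - intros x Hx; apply HF; lra.
  - intros x Hx; apply continuity_pt_filterlim.
    apply (ex_derive_continuous F x); exists (f x); apply HF; lra.
Qed.

Lemma nondecreasing_of_derive_nonneg (F f : R -> R) :
  (forall t : R, 0 < t -> is_derive F t (f t)) ->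
  (forall t : R, 0 < t -> 0 <= f t) ->
  forall u v : R, 0 < u -> u <= v -> F u <= F v.
Proof.
  intros HF Hf u v Hu Huv.
  destruct (mean_value_positive F f HF u v) as [c [Hc E]]; try lra.
  rewrite Rmin_left, Rmax_right in Hc by lra.
  assert (0 <= f c) by (apply Hf; lra).
  nra.
Qed.

(** The limit is the least upper bound of the values; that it bounds all of them
    is kept in the conclusion because positivity of Gamma rests on it. *)
Lemma nondecreasing_bounded_limit (F : R -> R) (K : R) :
  (forall u v : R, 0 < u -> u <= v -> F u <= F v) ->
  (forall u : R, 0 < u -> F u <= K) ->
  exists l : R, filterlim F (Rbar_locally p_infty) (locally l) /\
    forall u : R, 0 < u -> F u <= l.
Proof.
  intros Hmono HK.
  destruct (completeness (fun y : R => exists u : R, 0 < u /\ y = F u))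
    as [l [Hub Hlub]].
  - exists K; intros y [u [Hu ->]]; now apply HK.
  - exists (F 1), 1; split; [lra | reflexivity].
  - exists l.
    assert (Hl : forall u : R, 0 < u -> F u <= l)
      by (intros u Hu; apply Hub; now exists u).
    split; [ | exact Hl].
    apply filterlim_locally; intros eps.
    destruct (Classical_Prop.classic (exists u : R, 0 < u /\ l - eps < F u))
      as [[u [Hu Hlu]] | Hno].
    + exists u; intros v Hv.
      assert (F u <= F v) by (apply Hmono; lra).
      assert (F v <= l) by (apply Hl; lra).
      change (Rabs (F v - l) < eps); apply Rabs_lt_between'.
      pose proof (cond_pos eps); lra.
    + assert (l <= l - eps).
      { apply Hlub; intros y [u [Hu ->]].
        apply Rnot_lt_le; intros Hlt; apply Hno; now exists u. }
      pose proof (cond_pos eps); lra.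
Qed.

(** The substitution [u -> / u] with a change of sign exchanges the two ends of
    the half-line and preserves monotonicity. *)
Lemma nondecreasing_bounded_limit_0 (F : R -> R) (K : R) :
  (forall u v : R, 0 < u -> u <= v -> F u <= F v) ->
  (forall u : R, 0 < u -> K <= F u) ->
  exists l : R, filterlim F (at_right 0) (locally l) /\
    forall u : R, 0 < u -> l <= F u.
Proof.
  intros Hmono HK.
  destruct (nondecreasing_bounded_limit (fun u : R => - F (/ u)) (- K))
    as [l [Hl Hle]].
  - intros u v Hu Huv; apply Ropp_le_contravar, Hmono.
    + apply Rinv_0_lt_compat; lra.
    + now apply Rinv_le_contravar.
  - intros u Hu; apply Ropp_le_contravar, HK; now apply Rinv_0_lt_compat.
  - exists (- l); split.
    + apply filterlim_ext with (f := fun u : R => - - F (/ / u)).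
      { intros u; rewrite Ropp_involutive, Rinv_inv; reflexivity. }
      apply (filterlim_comp _ _ _ Rinv (fun v : R => - - F (/ v)) _
               (Rbar_locally p_infty) _ filterlim_Rinv_0_right).
      apply (filterlim_comp _ _ _ (fun v : R => - F (/ v)) Ropp _ (locally l) _ Hl).
      apply (filterlim_opp l).
    + intros u Hu; specialize (Hle (/ u) (Rinv_0_lt_compat u Hu)).
      rewrite Rinv_inv in Hle; lra.
Qed.

(** Every segment with endpoints close to the two ends stays inside the positive
    half-line, so hypotheses on that half-line alone are enough. *)
Lemma improper_integral_of_antiderivative (F f : R -> R) (A B : R) :
  (forall t : R, 0 < t -> is_derive F t (f t)) ->
  (forall t : R, 0 < t -> continuous f t) ->
  filterlim F (at_right 0) (locally A) ->
  filterlim F (Rbar_locally p_infty) (locally B) ->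
  is_RInt_gen f (at_right 0) (Rbar_locally p_infty) (B - A).
Proof.
  intros HF Hc HA HB.
  assert (Hpos : forall P : R -> Prop, (forall t : R, 0 < t -> P t) ->
    filter_prod (at_right 0) (Rbar_locally p_infty) (fun ab : R * R =>
      forall t : R, Rmin (fst ab) (snd ab) <= t <= Rmax (fst ab) (snd ab) -> P t)).
  { intros P HP.
    apply (Filter_prod _ _ _ (fun t : R => 0 < t) (fun t : R => 0 < t)).
    - exists (mkposreal 1 Rlt_0_1); intros; assumption.
    - exists 0; intros; assumption.
    - intros u v Hu Hv t Ht; apply HP; cbn in Ht.
      assert (0 < Rmin u v) by now apply Rmin_glb_lt.
      lra. }
  assert (HD : forall t : R, 0 < t -> Derive F t = f t)
    by (intros t Ht; now apply is_derive_unique, HF).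
  apply is_RInt_gen_ext with (Derive F).
  - generalize (Hpos _ HD); apply filter_imp; intros ab H t Ht; apply H; lra.
  - apply is_RInt_gen_Derive; try assumption.
    + apply Hpos; intros t Ht; exists (f t); now apply HF.
    + apply Hpos; intros t Ht; apply continuous_ext_loc with f.
      * generalize (locally_positive t Ht); apply filter_imp.
        intros s Hs; symmetry; now apply HD.
      * now apply Hc.
Qed.

(** * Hyperbolic functions *)

Lemma sinh_ge_id (y : R) : 0 <= y -> y <= sinh y.
Proof.
  intros Hy.
  destruct (MVT_gen sinh 0 y cosh) as [c [_ E]].
  - intros x _; apply is_derive_Reals, derivable_pt_lim_sinh.
  - intros x _; apply derivable_continuous_pt, derivable_pt_sinh.
  - rewrite sinh_0 in E.
    assert (1 <= cosh c).
    { unfold cosh; pose proof (exp_pos c); pose proof (exp_pos (- c)).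
      assert (exp c * exp (- c) = 1) by (rewrite <- exp_plus, Rplus_opp_r; apply exp_0).
      pose proof (pow2_ge_0 (exp c - exp (- c))); nra. }
    nra.
Qed.

Lemma cosh_pos (x : R) : 0 < cosh x.
Proof. unfold cosh; pose proof (exp_pos x); pose proof (exp_pos (- x)); lra. Qed.

Lemma cosh_double (x : R) : cosh (2 * x) = 2 * cosh x ^ 2 - 1
  /\ cosh (2 * x) = 1 + 2 * sinh x ^ 2.
Proof.
  assert (exp x * exp (- x) = 1) by (rewrite <- exp_plus, Rplus_opp_r; apply exp_0).
  unfold cosh, sinh.
  replace (2 * x) with (x + x) by ring.
  replace (- (x + x)) with (- x + - x) by ring.
  rewrite !exp_plus; split; nra.
Qed.

Lemma cosh_mult (x y : R) : cosh (x - y) * cosh (x + y) = (cosh (2 * x) + cosh (2 * y)) / 2.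
Proof.
  unfold cosh.
  replace (2 * x) with (x - y + (x + y)) by ring.
  replace (2 * y) with (x + y + - (x - y)) by ring.
  rewrite !Ropp_plus_distr, Ropp_involutive, !exp_plus.
  replace (- (x - y)) with (- x + y) by ring.
  unfold Rminus.
  rewrite ?Ropp_plus_distr, ?Ropp_involutive, !exp_plus; field.
Qed.

(** * Log-concavity *)

Definition concave_on_positives (phi : R -> R) : Prop :=
  forall x y lambda : R, 0 < x -> 0 < y -> 0 < lambda < 1 ->
    lambda * phi x + (1 - lambda) * phi y <= phi (lambda * x + (1 - lambda) * y).

Lemma exp_monotone (x y : R) : x <= y -> exp x <= exp y.
Proof.
  intros [H | ->]; [now apply Rlt_le, exp_increasing | apply Rle_refl].
Qed.

Lemma log_concave_on_exp (g phi : R -> R) :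
  (forall t : R, 0 < t -> g t = exp (phi t)) ->
  log_concave_on (fun t : R => 0 < t) g <->
  concave_on_positives phi.
Proof.
  intros Hg.
  assert (Hpow : forall t l : R, 0 < t -> pow_nonneg (g t) l = exp (l * phi t)).
  { intros t l Ht; unfold pow_nonneg; rewrite Hg by exact Ht.
    destruct (Req_EM_T (exp (phi t)) 0) as [E | _].
    - pose proof (exp_pos (phi t)); lra.
    - unfold Rpower; now rewrite ln_exp. }
  assert (Hconv : forall x y l : R, 0 < x -> 0 < y -> 0 < l < 1 ->
    0 < l * x + (1 - l) * y) by (intros; nra).
  split.
  - intros [_ H] x y l Hx Hy Hl; specialize (H x y l Hx Hy Hl).
    rewrite !Hpow, Hg, <- exp_plus in H by auto.
    apply Rnot_lt_le; intros Hlt; apply exp_increasing in Hlt; lra.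
  - intros H; split.
    + intros t Ht; rewrite Hg by exact Ht; apply Rlt_le, exp_pos.
    + intros x y l Hx Hy Hl; rewrite !Hpow, Hg, <- exp_plus by auto.
      apply exp_monotone; auto.
Qed.

(** The derivative decreases, so by the mean value theorem the graph lies below
    its tangent at the intermediate point [m]; averaging the tangent bound at [x]
    and [y] cancels the slope. *)
Lemma concave_of_second_derivative (phi dphi d2phi : R -> R) :
  (forall t : R, 0 < t -> is_derive phi t (dphi t)) ->
  (forall t : R, 0 < t -> is_derive dphi t (d2phi t)) ->
  (forall t : R, 0 < t -> d2phi t <= 0) ->
  concave_on_positives phi.
Proof.
  intros H1 H2 H3 x y l Hx Hy Hl; set (m := l * x + (1 - l) * y).
  assert (Hm : 0 < m) by (unfold m; nra).
  assert (Hdec : forall u v : R, 0 < u -> u <= v -> dphi v <= dphi u).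
  { intros u v Hu Huv; apply Ropp_le_cancel.
    apply (nondecreasing_of_derive_nonneg (fun t : R => - dphi t) (fun t : R => - d2phi t));
      try assumption.
    - intros t Ht; apply (is_derive_opp dphi); now apply H2.
    - intros t Ht; specialize (H3 t Ht); lra. }
  assert (Htan : forall z : R, 0 < z -> phi z <= phi m + dphi m * (z - m)).
  { intros z Hz.
    destruct (mean_value_positive phi dphi H1 m z Hm Hz) as [c [Hc E]].
    destruct (Rle_dec m z) as [Hmz | Hmz].
    - rewrite Rmin_left, Rmax_right in Hc by lra.
      pose proof (Hdec m c Hm ltac:(lra)); nra.
    - rewrite Rmin_right, Rmax_left in Hc by lra.
      pose proof (Hdec c m ltac:(lra) ltac:(lra)); nra. }
  pose proof (Rmult_le_compat_l l _ _ ltac:(lra) (Htan x Hx)).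
  pose proof (Rmult_le_compat_l (1 - l) _ _ ltac:(lra) (Htan y Hy)).
  assert (Hbary : l * (x - m) + (1 - l) * (y - m) = 0) by (unfold m; ring).
  assert (dphi m * (l * (x - m) + (1 - l) * (y - m)) = 0) by (rewrite Hbary; ring).
  lra.
Qed.

(** * Euler's Gamma integral *)

Definition gamma_integrand (x t : R) : R := Rpower t (x - 1) * exp (- t).

Lemma is_derive_Rpower_l (x t : R) : 0 < t ->
  is_derive (fun s : R => Rpower s x) t (x * Rpower t (x - 1)).
Proof.
  intros Ht; unfold Rpower; auto_derive; [exact Ht | ].
  replace ((x - 1) * ln t) with (x * ln t + - ln t) by ring.
  rewrite exp_plus, exp_Ropp, exp_ln by exact Ht.
  field; lra.
Qed.

Lemma Rpower_pos (t x : R) : 0 < Rpower t x.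
Proof. apply exp_pos. Qed.

Lemma gamma_integrand_pos (x t : R) : 0 < gamma_integrand x t.
Proof. apply Rmult_lt_0_compat; apply exp_pos. Qed.

Lemma gamma_integrand_continuous (x t : R) : 0 < t ->
  continuous (gamma_integrand x) t.
Proof.
  intros Ht; apply (ex_derive_continuous (gamma_integrand x) t).
  unfold gamma_integrand, Rpower; auto_derive; exact Ht.
Qed.

(** Applying [ln s <= s] to [s = t / (2 * x)] gives
    [x * ln t <= t / 2 + x * ln (2 * x)]. *)
Lemma Rpower_le_exp_half (x : R) : 0 < x ->
  exists C : R, 0 < C /\ forall t : R, 0 < t -> Rpower t x <= C * exp (t / 2).
Proof.
  intros Hx; exists (exp (x * ln (2 * x))); split; [apply exp_pos | ].
  intros t Ht; unfold Rpower; rewrite <- exp_plus; apply exp_monotone.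
  assert (Hq : 0 < t / (2 * x)) by (apply Rdiv_lt_0_compat; lra).
  assert (E : ln t = ln (t / (2 * x)) + ln (2 * x)).
  { rewrite <- ln_mult by lra; f_equal; field; lra. }
  assert (L : ln (t / (2 * x)) <= t / (2 * x)).
  { pose proof (exp_ineq1_le (ln (t / (2 * x)))) as H.
    rewrite exp_ln in H by exact Hq; lra. }
  replace (t / 2) with (x * (t / (2 * x))) by (field; lra).
  rewrite E; nra.
Qed.

Lemma exp_half_sqr (t : R) : exp (t / 2) * exp (t / 2) = exp t.
Proof. rewrite <- exp_plus; f_equal; field. Qed.

(** The bounded function [K * t^x / (1 + t^x)] has derivative
    [K * x * t^(x-1) / (1 + t^x)^2]. As [1 + t^x] is at most a multiple of
    [exp (t / 2)], this dominates [t^(x-1) * exp (- t)] once [K] is large: a single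
    majorant controls the integral at both ends. *)
Lemma gamma_integrand_majorant (x : R) : 0 < x ->
  exists (K : R) (G g : R -> R),
    (forall t : R, 0 < t -> is_derive G t (g t)) /\
    (forall t : R, 0 < t -> gamma_integrand x t <= g t) /\
    (forall t : R, 0 <= G t <= K).
Proof.
  intros Hx; destruct (Rpower_le_exp_half x Hx) as [C [HC Hb]].
  set (K := (1 + C) ^ 2 / x).
  assert (HK : 0 < K) by (apply Rdiv_lt_0_compat; nra).
  exists K, (fun t : R => K * (1 - / (1 + Rpower t x))),
    (fun t : R => K * (x * Rpower t (x - 1) / (1 + Rpower t x) ^ 2)).
  split; [ | split].
  - intros t Ht.
    assert (HD := is_derive_Rpower_l x t Ht).
    assert (Hp := Rpower_pos t x).
    auto_derive.
    + split; [exists (x * Rpower t (x - 1)); exact HD | ].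
      split; [lra | exact I].
    + rewrite (is_derive_unique _ _ _ HD); field; lra.
  - intros t Ht; unfold gamma_integrand.
    assert (Hp := Rpower_pos t x).
    assert (Hq := Rpower_pos t (x - 1)).
    assert (He := exp_pos t).
    assert (He1 : 1 <= exp (t / 2)) by (pose proof (exp_ineq1_le (t / 2)); lra).
    replace (K * (x * Rpower t (x - 1) / (1 + Rpower t x) ^ 2))
      with (Rpower t (x - 1) * ((1 + C) ^ 2 / (1 + Rpower t x) ^ 2))
      by (unfold K; field; lra).
    apply Rmult_le_compat_l; [lra | ].
    rewrite exp_Ropp; apply (Rmult_le_reg_l (exp t)); [exact He | ].
    rewrite Rinv_r by lra.
    apply (Rmult_le_reg_r ((1 + Rpower t x) ^ 2)); [nra | ].
    replace (exp t * ((1 + C) ^ 2 / (1 + Rpower t x) ^ 2) * (1 + Rpower t x) ^ 2)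
      with (((1 + C) * exp (t / 2)) ^ 2)
      by (rewrite <- (exp_half_sqr t); field; lra).
    rewrite Rmult_1_l; apply pow_incr; split; [lra | ].
    specialize (Hb t Ht); lra.
  - intros t; assert (Hp := Rpower_pos t x).
    assert (0 < / (1 + Rpower t x) <= 1).
    { split; [apply Rinv_0_lt_compat; lra | ].
      rewrite <- Rinv_1; apply Rinv_le_contravar; lra. }
    nra.
Qed.

(** The antiderivative vanishing at 1 increases and, being dominated, is bounded;
    it therefore has limits at 0 and at infinity. They differ because it increases
    strictly between 1 and 2. *)
Lemma gamma_integral (x : R) : 0 < x ->
  is_RInt_gen (gamma_integrand x) (at_right 0) (Rbar_locally p_infty) (Gamma x)
  /\ 0 < Gamma x.
Proof.
  intros Hx.
  set (f := gamma_integrand x); set (F := fun u : R => RInt f 1 u).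
  assert (HF : forall t : R, 0 < t -> is_derive F t (f t)).
  { intros t Ht; apply is_derive_RInt with 1.
    - generalize (locally_positive t Ht); apply filter_imp; intros s Hs.
      apply (RInt_correct f 1 s), ex_RInt_continuous; intros z Hz.
      apply gamma_integrand_continuous.
      assert (0 < Rmin 1 s) by (apply Rmin_glb_lt; lra); lra.
    - now apply gamma_integrand_continuous. }
  assert (Hf : forall t : R, 0 < f t) by (intros t; apply gamma_integrand_pos).
  assert (Hmono : forall u v : R, 0 < u -> u <= v -> F u <= F v).
  { apply nondecreasing_of_derive_nonneg with f; [exact HF | ].
    intros t _; apply Rlt_le, Hf. }
  destruct (gamma_integrand_majorant x Hx) as [K [G [g [HG [Hfg HGK]]]]].
  assert (HGF : forall u v : R, 0 < u -> u <= v -> G u - F u <= G v - F v).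
  { apply (nondecreasing_of_derive_nonneg (fun t : R => G t - F t)
             (fun t : R => g t - f t)).
    - intros t Ht; apply (is_derive_minus G F); [now apply HG | now apply HF].
    - intros t Ht; specialize (Hfg t Ht); unfold f; lra. }
  assert (Hbound : forall u : R, 0 < u -> F 1 - K <= F u <= F 1 + K).
  { intros u Hu; pose proof (HGK 1); pose proof (HGK u).
    destruct (Rle_dec 1 u) as [H1 | H1].
    - pose proof (HGF 1 u ltac:(lra) H1); pose proof (Hmono 1 u ltac:(lra) H1); lra.
    - pose proof (HGF u 1 Hu ltac:(lra)); pose proof (Hmono u 1 Hu ltac:(lra)); lra. }
  destruct (nondecreasing_bounded_limit F (F 1 + K) Hmono) as [B [HB HleB]];
    [intros u Hu; now apply Hbound | ].
  destruct (nondecreasing_bounded_limit_0 F (F 1 - K) Hmono) as [A [HA HleA]];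
    [intros u Hu; now apply Hbound | ].
  assert (HI : is_RInt_gen f (at_right 0) (Rbar_locally p_infty) (B - A)).
  { apply improper_integral_of_antiderivative with F; try assumption.
    intros t; apply gamma_integrand_continuous. }
  assert (E : Gamma x = B - A) by (apply is_RInt_gen_unique, HI).
  rewrite E; split; [exact HI | ].
  destruct (mean_value_positive F f HF 1 2) as [c [_ Ec]]; try lra.
  pose proof (Hf c); pose proof (HleA 1 Rlt_0_1); pose proof (HleB 2 Rlt_0_2); lra.
Qed.

Lemma Gamma_pos (x : R) : 0 < x -> 0 < Gamma x.
Proof. intros Hx; apply (gamma_integral x Hx). Qed.

Lemma Rpower_exp_lim_0 (x : R) : 0 < x ->
  filterlim (fun t : R => Rpower t x * exp (- t)) (at_right 0) (locally 0).
Proof.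
  intros Hx; apply filterlim_locally; intros eps.
  exists (mkposreal (Rpower eps (/ x)) (Rpower_pos _ _)); intros t Ht Ht0.
  change (Rabs (t - 0) < Rpower eps (/ x)) in Ht.
  rewrite Rminus_0_r, Rabs_pos_eq in Ht by lra.
  assert (Hlt : Rpower t x < eps).
  { rewrite <- (Rpower_1 eps), <- (Rinv_l x), <- Rpower_mult
      by (try apply cond_pos; lra).
    apply Rlt_Rpower_l; lra. }
  assert (Hp := Rpower_pos t x); assert (He := exp_pos (- t)).
  assert (He1 : exp (- t) <= 1) by (rewrite <- exp_0; apply exp_monotone; lra).
  change (Rabs (Rpower t x * exp (- t) - 0) < eps).
  rewrite Rminus_0_r, Rabs_pos_eq; nra.
Qed.

Lemma Rpower_exp_lim_infty (x : R) : 0 < x ->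
  filterlim (fun t : R => Rpower t x * exp (- t))
    (Rbar_locally p_infty) (locally 0).
Proof.
  intros Hx; destruct (Rpower_le_exp_half x Hx) as [C [HC Hb]].
  apply filterlim_locally; intros eps; assert (Heps := cond_pos eps).
  exists (Rmax 0 (2 * ln (C / eps))); intros t Ht.
  assert (Ht0 : 0 < t) by (pose proof (Rmax_l 0 (2 * ln (C / eps))); lra).
  assert (Hq : 0 < C / eps) by now apply Rdiv_lt_0_compat.
  assert (Hlt : C / eps < exp (t / 2)).
  { rewrite <- (exp_ln (C / eps)) by exact Hq; apply exp_increasing.
    pose proof (Rmax_r 0 (2 * ln (C / eps))); lra. }
  assert (HC' : C < eps * exp (t / 2)).
  { replace C with (eps * (C / eps)) by (field; lra).
    now apply Rmult_lt_compat_l. }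
  assert (Hp := Rpower_pos t x); specialize (Hb t Ht0).
  change (Rabs (Rpower t x * exp (- t) - 0) < eps).
  assert (H2 := exp_pos (t / 2)).
  rewrite Rminus_0_r, exp_Ropp, <- (exp_half_sqr t), Rabs_pos_eq
    by (apply Rlt_le, Rdiv_lt_0_compat; nra).
  apply (Rmult_lt_reg_r (exp (t / 2) * exp (t / 2))); [nra | ].
  rewrite Rmult_assoc, Rinv_l, Rmult_1_r by nra.
  nra.
Qed.

(** Integration by parts: [- t^x * exp (- t)] vanishes at both ends. *)
Lemma Gamma_succ (x : R) : 0 < x -> Gamma (x + 1) = x * Gamma x.
Proof.
  intros Hx.
  assert (Hparts : is_RInt_gen
    (fun t : R => minus (scal x (gamma_integrand x t)) (gamma_integrand (x + 1) t))
    (at_right 0) (Rbar_locally p_infty) (0 - 0)).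
  { apply improper_integral_of_antiderivative
      with (fun t : R => Rpower t x * exp (- t)).
    - intros t Ht; assert (HD := is_derive_Rpower_l x t Ht).
      auto_derive; [exists (x * Rpower t (x - 1)); exact HD | ].
      rewrite (is_derive_unique _ _ _ HD).
      unfold gamma_integrand, minus, plus, opp, scal; cbn; unfold mult; cbn.
      replace (x + 1 - 1) with x by ring; ring.
    - intros t Ht.
      apply (ex_derive_continuous (fun s : R =>
        minus (scal x (gamma_integrand x s)) (gamma_integrand (x + 1) s)) t).
      unfold gamma_integrand, Rpower, minus, plus, opp, scal; cbn.
      unfold mult; cbn; auto_derive; repeat split; exact Ht.
    - now apply Rpower_exp_lim_0.
    - now apply Rpower_exp_lim_infty. }
  assert (Hlin := is_RInt_gen_minus _ _ _ _
    (is_RInt_gen_scal _ x _ (proj1 (gamma_integral x Hx)))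
    (proj1 (gamma_integral (x + 1) ltac:(lra)))).
  apply (is_RInt_gen_unique (V := R_CompleteNormedModule)) in Hparts.
  apply (is_RInt_gen_unique (V := R_CompleteNormedModule)) in Hlin.
  assert (E := eq_trans (eq_sym Hparts) Hlin).
  change (0 - 0 = x * Gamma x - Gamma (x + 1)) in E; lra.
Qed.

(** * The Bessel-Clifford function *)

Definition bessel_clifford_coeff (nu : R) (k : nat) : R :=
  / (INR (fact k) * Gamma (nu + INR k)).

(** The entire function [sum_k x^k / (k! Gamma (nu + k))], that is, I_(nu-1)
    freed from its power factor:
    [I_(nu-1) (z) = (z / 2)^(nu-1) * bessel_clifford nu (z^2 / 4)]. In this form it
    has a value at 0, and one formula for the Marcum integrand covers [a = 0]. *)
Definition bessel_clifford (nu x : R) : R := PSeries (bessel_clifford_coeff nu) x.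

Lemma INR_fact_pos (k : nat) : 0 < INR (fact k).
Proof. apply lt_0_INR, lt_O_fact. Qed.

Lemma bessel_clifford_coeff_pos (nu : R) (k : nat) : 0 < nu ->
  0 < bessel_clifford_coeff nu k.
Proof.
  intros Hnu; apply Rinv_0_lt_compat, Rmult_lt_0_compat.
  - apply INR_fact_pos.
  - apply Gamma_pos; pose proof (pos_INR k); lra.
Qed.

Lemma bessel_clifford_coeff_S (nu : R) (k : nat) : 0 < nu ->
  bessel_clifford_coeff nu k
  = INR (S k) * (nu + INR k) * bessel_clifford_coeff nu (S k).
Proof.
  intros Hnu; unfold bessel_clifford_coeff.
  assert (Hk := pos_INR k).
  replace (nu + INR (S k)) with (nu + INR k + 1) by (rewrite S_INR; ring).
  rewrite Gamma_succ by lra.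
  rewrite fact_simpl, mult_INR, S_INR.
  assert (Hg : 0 < Gamma (nu + INR k)) by (apply Gamma_pos; lra).
  assert (Hf := INR_fact_pos k).
  field; repeat split; lra.
Qed.

Lemma bessel_clifford_coeff_derive (nu : R) (k : nat) :
  PS_derive (bessel_clifford_coeff nu) k = bessel_clifford_coeff (nu + 1) k.
Proof.
  unfold PS_derive, bessel_clifford_coeff.
  replace (nu + INR (S k)) with (nu + 1 + INR k) by (rewrite S_INR; ring).
  rewrite fact_simpl, mult_INR, Rmult_assoc, Rinv_mult, <- Rmult_assoc.
  rewrite Rinv_r, Rmult_1_l; [reflexivity | now apply not_0_INR].
Qed.

Lemma bessel_clifford_radius (nu : R) : 0 < nu ->
  CV_radius (bessel_clifford_coeff nu) = p_infty.
Proof.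
  intros Hnu; apply CV_radius_infinite_DAlembert.
  - intros k; apply Rgt_not_eq, bessel_clifford_coeff_pos, Hnu.
  - apply is_lim_seq_le_le with (u := fun _ : nat => 0)
      (w := fun k : nat => / nu * / INR (S k)).
    + intros k; assert (Hk := pos_INR k).
      assert (HS : 0 < INR (S k)) by (apply lt_0_INR; lia).
      assert (Hp := bessel_clifford_coeff_pos nu (S k) Hnu).
      split; [apply Rabs_pos | ].
      rewrite (bessel_clifford_coeff_S nu k Hnu), Rabs_pos_eq
        by (apply Rlt_le, Rdiv_lt_0_compat; [ | apply Rmult_lt_0_compat]; nra).
      replace (bessel_clifford_coeff nu (S k) / _)
        with (/ (nu + INR k) * / INR (S k)) by (field; repeat split; lra).
      apply Rmult_le_compat_r; [now apply Rlt_le, Rinv_0_lt_compat | ].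
      apply Rinv_le_contravar; lra.
    + apply is_lim_seq_const.
    + replace (Finite 0) with (Rbar_mult (/ nu) 0)
        by (cbn; f_equal; ring).
      apply is_lim_seq_scal_l.
      apply (is_lim_seq_incr_1 (fun k : nat => / INR k)).
      apply (is_lim_seq_inv _ p_infty); [apply is_lim_seq_INR | discriminate].
Qed.

Lemma ex_bessel_clifford (nu x : R) : 0 < nu ->
  ex_pseries (bessel_clifford_coeff nu) x.
Proof.
  intros Hnu; apply CV_radius_inside; rewrite bessel_clifford_radius by exact Hnu.
  exact I.
Qed.

Lemma is_derive_bessel_clifford (nu x : R) : 0 < nu ->
  is_derive (bessel_clifford nu) x (bessel_clifford (nu + 1) x).
Proof.
  intros Hnu; unfold bessel_clifford at 2.
  rewrite <- (PSeries_ext _ _ x (bessel_clifford_coeff_derive nu)).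
  apply is_derive_PSeries; rewrite bessel_clifford_radius by exact Hnu.
  exact I.
Qed.

(** Together with the derivative rule this is Bessel's differential equation in
    the form [Phi = nu * Phi' + x * Phi'']. *)
Lemma bessel_clifford_recurrence (nu x : R) : 0 < nu ->
  bessel_clifford nu x
  = nu * bessel_clifford (nu + 1) x + x * bessel_clifford (nu + 2) x.
Proof.
  intros Hnu; unfold bessel_clifford.
  rewrite <- PSeries_incr_1, <- PSeries_scal, <- PSeries_plus.
  - apply PSeries_ext; intros k; unfold PS_plus, PS_scal.
    rewrite bessel_clifford_coeff_S by exact Hnu.
    unfold plus, scal; cbn -[INR]; unfold mult; cbn -[INR].
    rewrite <- bessel_clifford_coeff_derive; unfold PS_derive.
    destruct k as [ | k]; cbn -[INR].
    + change (INR 0) with 0; change zero with 0; ring.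
    + replace (nu + 2) with (nu + 1 + 1) by ring.
      rewrite <- bessel_clifford_coeff_derive; unfold PS_derive.
      rewrite <- bessel_clifford_coeff_derive; unfold PS_derive.
      ring.
  - apply ex_pseries_scal; [apply Rmult_comm | ].
    apply ex_bessel_clifford; lra.
  - apply ex_pseries_incr_1, ex_bessel_clifford; lra.
Qed.

Lemma bessel_clifford_pos (nu x : R) : 0 < nu -> 0 <= x -> 0 < bessel_clifford nu x.
Proof.
  intros Hnu Hx; unfold bessel_clifford.
  rewrite PSeries_decr_1 by (apply ex_bessel_clifford, Hnu).
  apply Rplus_lt_le_0_compat; [now apply bessel_clifford_coeff_pos | ].
  apply Rmult_le_pos; [exact Hx | ].
  replace 0 with (Series (fun _ : nat => 0 * 0))
    by (rewrite Series_scal_l; ring).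
  apply Series_le.
  - intros k; split; [lra | ]; rewrite Rmult_0_l.
    apply Rmult_le_pos; [ | now apply pow_le].
    apply Rlt_le, bessel_clifford_coeff_pos, Hnu.
  - apply ex_pseries_R.
    apply CV_radius_inside; rewrite CV_radius_decr_1, bessel_clifford_radius by exact Hnu.
    exact I.
Qed.

(** By Bessel's equation [h z = bessel_clifford (1 / 2) (z^2 / 4)] satisfies
    [h'' = h] and [h' 0 = 0], which characterizes the multiples of [cosh]. *)
Lemma bessel_clifford_half (z : R) : 0 < z ->
  bessel_clifford (1 / 2) (z ^ 2 / 4) = bessel_clifford (1 / 2) 0 * cosh z.
Proof.
  intros Hz.
  set (h := fun s : R => bessel_clifford (1 / 2) (s ^ 2 / 4)).
  set (k := fun s : R => s / 2 * bessel_clifford (1 / 2 + 1) (s ^ 2 / 4)).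
  assert (Hsq : forall s : R, is_derive (fun x : R => x ^ 2 / 4) s (s / 2))
    by (intros s; auto_derive; [exact I | field]).
  assert (Hh : forall s : R, is_derive h s (k s)).
  { intros s; apply (is_derive_comp (bessel_clifford (1 / 2)) _ s _ _); [ | apply Hsq].
    apply is_derive_bessel_clifford; lra. }
  assert (Hk : forall s : R, is_derive k s (h s)).
  { intros s.
    set (w := fun x : R => bessel_clifford (1 / 2 + 1) (x ^ 2 / 4)).
    assert (Hw : is_derive w s (s / 2 * bessel_clifford (1 / 2 + 1 + 1) (s ^ 2 / 4))).
    { apply (is_derive_comp (bessel_clifford (1 / 2 + 1)) _ s _ _); [ | apply Hsq].
      apply is_derive_bessel_clifford; lra. }
    change k with (fun x : R => x / 2 * w x).
    auto_derive; [eexists; exact Hw | ].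
    rewrite (is_derive_unique (fun x : R => w x) s _ Hw).
    unfold h, w; rewrite (bessel_clifford_recurrence (1 / 2)) by lra.
    replace (1 / 2 + 1 + 1) with (1 / 2 + 2) by ring.
    field. }
  (* With [k = h'], both [(h + k) exp (- s)] and [(h - k) exp s] are constant. *)
  assert (Hconst : forall e : R, e ^ 2 = 1 ->
    h z + e * k z = bessel_clifford (1 / 2) 0 * exp (e * z)).
  { intros e He.
    assert (E : (h 0 + e * k 0) * exp (- (e * 0)) = (h z + e * k z) * exp (- (e * z))).
    { apply (eq_is_derive (fun s : R => (h s + e * k s) * exp (- (e * s)))); [ | exact Hz].
      intros s _; change zero with 0; auto_derive.
      - repeat split; eexists; [apply Hh | apply Hk].
      - rewrite (is_derive_unique (fun x : R => h x) s _ (Hh s)).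
        rewrite (is_derive_unique (fun x : R => k x) s _ (Hk s)).
        transitivity ((1 - e ^ 2) * k s * exp (- (e * s))); [ring | rewrite He; ring]. }
    replace (bessel_clifford (1 / 2) 0) with ((h 0 + e * k 0) * exp (- (e * 0))).
    - rewrite E, Rmult_assoc, <- exp_plus, Rplus_opp_l, exp_0; ring.
    - unfold h, k; replace (0 ^ 2 / 4) with 0 by field.
      rewrite Rmult_0_r, Ropp_0, exp_0; field. }
  pose proof (Hconst 1 ltac:(ring)) as E1; pose proof (Hconst (-1) ltac:(ring)) as E2.
  replace (1 * z) with z in E1 by ring; replace (-1 * z) with (- z) in E2 by ring.
  fold (h z); unfold cosh; lra.
Qed.

Lemma BesselI_bessel_clifford (mu t : R) : 0 < t ->
  BesselI mu t = Rpower (t / 2) mu * bessel_clifford (mu + 1) (t ^ 2 / 4).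
Proof.
  intros Ht; unfold BesselI, bessel_clifford, PSeries.
  rewrite <- Series_scal_l; apply Series_ext; intros k.
  unfold bessel_clifford_coeff.
  replace (mu + INR k + 1) with (mu + 1 + INR k) by ring.
  replace (2 * INR k) with (INR (2 * k)) by (rewrite mult_INR; reflexivity).
  rewrite Rpower_plus, Rpower_pow, pow_mult by lra.
  replace ((t / 2) ^ 2) with (t ^ 2 / 4) by field.
  unfold Rdiv; ring.
Qed.

(** * The Marcum integrand *)

Definition log_marcum (nu a t : R) : R :=
  (1 - nu) * ln 2 - a ^ 2 / 2 + (2 * nu - 1) * ln t - t ^ 2 / 2
  + ln (bessel_clifford nu ((a * t) ^ 2 / 4)).

Lemma marcum_integrand_exp (nu a t : R) : 0 < nu -> 0 <= a -> 0 < t ->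
  marcum_integrand nu a t = exp (log_marcum nu a t).
Proof.
  intros Hnu Ha Ht; unfold log_marcum.
  rewrite exp_plus, (exp_ln (bessel_clifford _ _))
    by (apply bessel_clifford_pos; [exact Hnu | pose proof (pow2_ge_0 (a * t)); lra]).
  unfold marcum_integrand; destruct (Req_EM_T a 0) as [-> | Hne].
  - replace ((0 * t) ^ 2 / 4) with 0 by field.
    unfold bessel_clifford; rewrite PSeries_0; unfold bessel_clifford_coeff.
    change (INR (fact 0)) with 1; change (INR 0) with 0.
    rewrite Rplus_0_r, Rmult_1_l.
    unfold Rdiv, Rpower; rewrite Rinv_mult, <- exp_Ropp.
    transitivity (exp ((2 * nu - 1) * ln t) * exp (- ((nu - 1) * ln 2))
      * exp (- (t ^ 2 * / 2)) * / Gamma nu); [ring | ].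
    rewrite <- !exp_plus; f_equal; f_equal; field.
  - assert (Ha' : 0 < a) by lra.
    assert (Hat : 0 < a * t) by now apply Rmult_lt_0_compat.
    rewrite BesselI_bessel_clifford by exact Hat.
    replace (nu - 1 + 1) with nu by ring.
    rewrite <- Rmult_assoc; f_equal.
    unfold Rdiv, Rpower; rewrite <- exp_Ropp, <- !exp_plus; f_equal.
    rewrite ln_mult, ln_mult, ln_Rinv by lra.
    field.
Qed.

(** With [u = (a t)^2 / 4] and [r = Phi_(nu+1) (u) / Phi_nu (u) > 0], Bessel's
    equation turns the second derivative of the logarithm into
    [- (2 nu - 1) / t^2 - (1 - a^2) - a^2 ((nu - 1/2) r + u r^2)], a sum of
    nonpositive terms. *)
Lemma log_marcum_concave (nu a : R) : 1 / 2 <= nu -> 0 <= a <= 1 ->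
  concave_on_positives (log_marcum nu a).
Proof.
  intros Hnu Ha.
  set (u := fun t : R => (a * t) ^ 2 / 4).
  set (P0 := fun t : R => bessel_clifford nu (u t)).
  set (P1 := fun t : R => bessel_clifford (nu + 1) (u t)).
  set (P2 := fun t : R => bessel_clifford (nu + 2) (u t)).
  assert (Hu0 : forall t : R, 0 <= u t)
    by (intros t; unfold u; pose proof (pow2_ge_0 (a * t)); lra).
  assert (Hp0 : forall t : R, 0 < P0 t)
    by (intros t; apply bessel_clifford_pos; [lra | apply Hu0]).
  assert (Hp1 : forall t : R, 0 < P1 t)
    by (intros t; apply bessel_clifford_pos; [lra | apply Hu0]).
  assert (Hrec : forall t : R, P0 t = nu * P1 t + u t * P2 t)
    by (intros t; apply bessel_clifford_recurrence; lra).
  assert (Hdu : forall t : R, is_derive u t (a ^ 2 * t / 2))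
    by (intros t; unfold u; auto_derive; [exact I | field]).
  assert (Hd0 : forall t : R, is_derive P0 t (a ^ 2 * t / 2 * P1 t)).
  { intros t; apply (is_derive_comp (bessel_clifford nu) u); [ | apply Hdu].
    apply is_derive_bessel_clifford; lra. }
  assert (Hd1 : forall t : R, is_derive P1 t (a ^ 2 * t / 2 * P2 t)).
  { intros t; apply (is_derive_comp (bessel_clifford (nu + 1)) u); [ | apply Hdu].
    unfold P2; replace (nu + 2) with (nu + 1 + 1) by ring.
    apply is_derive_bessel_clifford; lra. }
  apply concave_of_second_derivative with
    (fun t : R => (2 * nu - 1) / t - t + a ^ 2 * t / 2 * (P1 t / P0 t))
    (fun t : R => - ((2 * nu - 1) / t ^ 2) - 1 + a ^ 2 / 2 * (P1 t / P0 t)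
       + (a ^ 2 * t / 2) ^ 2 * (P2 t / P0 t - (P1 t / P0 t) ^ 2)).
  - intros t Ht; specialize (Hp0 t).
    change (log_marcum nu a) with (fun s : R => (1 - nu) * ln 2 - a ^ 2 / 2
      + (2 * nu - 1) * ln s - s ^ 2 / 2 + ln (P0 s)).
    auto_derive.
    + repeat split; try assumption; eexists; apply Hd0.
    + rewrite (is_derive_unique (fun s : R => P0 s) t _ (Hd0 t)); field; lra.
  - intros t Ht; specialize (Hp0 t).
    auto_derive.
    + repeat split; try lra; eexists; [apply Hd1 | apply Hd0].
    + rewrite (is_derive_unique (fun s : R => P0 s) t _ (Hd0 t)).
      rewrite (is_derive_unique (fun s : R => P1 s) t _ (Hd1 t)).
      field; lra.
  - intros t Ht; specialize (Hp0 t); specialize (Hp1 t); specialize (Hrec t).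
    set (r := P1 t / P0 t).
    assert (Hr : 0 < r) by now apply Rdiv_lt_0_compat.
    replace ((a ^ 2 * t / 2) ^ 2 * (P2 t / P0 t - r ^ 2))
      with (a ^ 2 * (1 - nu * r - u t * r ^ 2)).
    2: { unfold r; transitivity (a ^ 2 * (u t * P2 t / P0 t - u t * (P1 t / P0 t) ^ 2)).
         - replace (u t * P2 t) with (P0 t - nu * P1 t) by lra; field; lra.
         - unfold u; field; lra. }
    assert (0 <= (2 * nu - 1) / t ^ 2)
      by (apply Rmult_le_pos; [lra | apply Rlt_le, Rinv_0_lt_compat; nra]).
    specialize (Hu0 t).
    assert (0 <= a ^ 2 * (u t * r ^ 2 + (nu - 1 / 2) * r)).
    { apply Rmult_le_pos; [nra | ]; apply Rplus_le_le_0_compat.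
      - apply Rmult_le_pos; nra.
      - apply Rmult_le_pos; lra. }
    nra.
Qed.

Lemma log_marcum_half (a t : R) : 0 < a -> 0 < t ->
  log_marcum (1 / 2) a t
  = log_marcum (1 / 2) a 0 - t ^ 2 / 2 + ln (cosh (a * t)).
Proof.
  intros Ha Ht; unfold log_marcum.
  rewrite bessel_clifford_half by now apply Rmult_lt_0_compat.
  replace ((a * 0) ^ 2 / 4) with 0 by field.
  (* The term in [ln t] has coefficient [2 * (1 / 2) - 1 = 0], which makes the
     value at 0 the constant term. *)
  rewrite ln_mult; [field | apply bessel_clifford_pos; lra | apply cosh_pos].
Qed.

(** Concavity at [m - d] and [m + d] says
    [cosh (a (m - d)) * cosh (a (m + d)) <= cosh (a m)^2 * exp (d^2)], and the
    product formula for [cosh] makes both sides linear in [cosh (2 a m)]. The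
    estimates [cosh (2 a d) >= 1 + 2 (a d)^2] and
    [exp (d^2) * (1 - d^2) <= 1] leave a factor [d^2] that cancels. *)
Lemma log_marcum_half_midpoint (a m d : R) : 0 < a -> 0 < d < m ->
  concave_on_positives (log_marcum (1 / 2) a) ->
  2 * a ^ 2 * (1 - d ^ 2) <= cosh (2 * (a * m)) + 1.
Proof.
  intros Ha Hd H.
  specialize (H (m - d) (m + d) (1 / 2) ltac:(lra) ltac:(lra) ltac:(lra)).
  replace (1 / 2 * (m - d) + (1 - 1 / 2) * (m + d)) with m in H by field.
  rewrite (log_marcum_half a (m - d)), (log_marcum_half a (m + d)),
    (log_marcum_half a m) in H by lra.
  assert (HL : ln (cosh (a * m - a * d) * cosh (a * m + a * d))
               <= ln (cosh (a * m) ^ 2 * exp (d ^ 2))).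
  { rewrite !ln_mult, ln_exp by (try apply exp_pos; try apply pow_lt; apply cosh_pos).
    replace (cosh (a * m) ^ 2) with (cosh (a * m) * cosh (a * m)) by ring.
    rewrite ln_mult by apply cosh_pos.
    replace (a * (m - d)) with (a * m - a * d) in H by ring.
    replace (a * (m + d)) with (a * m + a * d) in H by ring.
    lra. }
  assert (HM : cosh (a * m - a * d) * cosh (a * m + a * d)
               <= cosh (a * m) ^ 2 * exp (d ^ 2)).
  { apply Rnot_lt_le; intros Hlt; apply Rlt_not_le in HL; [exact HL | ].
    apply ln_increasing; [ | exact Hlt].
    apply Rmult_lt_0_compat; [apply pow_lt, cosh_pos | apply exp_pos]. }
  rewrite cosh_mult in HM.
  destruct (cosh_double (a * m)) as [Em _]; destruct (cosh_double (a * d)) as [_ Ed].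
  assert (Had : 0 <= a * d) by (apply Rmult_le_pos; lra).
  assert (Hs := pow_incr _ _ 2 (conj Had (sinh_ge_id _ Had))).
  assert (Hq : 1 + 2 * (a * d) ^ 2 <= cosh (2 * (a * d))) by lra.
  assert (Hp := cosh_pos (2 * (a * m))).
  set (p := cosh (2 * (a * m))) in *; set (q := cosh (2 * (a * d))) in *.
  assert (He : exp (d ^ 2) * (1 - d ^ 2) <= 1).
  { pose proof (exp_ineq1_le (- d ^ 2)) as He; pose proof (exp_pos (d ^ 2)).
    assert (exp (d ^ 2) * exp (- d ^ 2) = 1)
      by (rewrite <- exp_plus, Rplus_opp_r; apply exp_0).
    nra. }
  destruct (Rle_dec 1 (d ^ 2)) as [Hd1 | Hd1].
  { pose proof (Rmult_le_pos (a ^ 2) (d ^ 2 - 1) (pow2_ge_0 a) ltac:(lra)); lra. }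
  assert (HN : (p + q) * (1 - d ^ 2) <= p + 1).
  { assert ((p + q) / 2 * (1 - d ^ 2) <= (p + 1) / 2 * (exp (d ^ 2) * (1 - d ^ 2))).
    { replace ((p + 1) / 2) with (cosh (a * m) ^ 2) by lra.
      rewrite <- Rmult_assoc; apply Rmult_le_compat_r; lra. }
    nra. }
  assert (HN' : (p + (1 + 2 * (a * d) ^ 2)) * (1 - d ^ 2) <= p + 1) by nra.
  assert (Hdd : 0 < d ^ 2) by (apply pow_lt; lra).
  apply (Rmult_le_reg_l (d ^ 2)); [exact Hdd | ].
  lra.
Qed.

Theorem proposition1 (a : R) (ha : 0 <= a) :
  (forall nu : R, 1 / 2 <= nu ->
     log_concave_on (fun t : R => 0 < t) (marcum_integrand nu a))
  <-> 0 <= a <= 1.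
Proof.
  split.
  - intros H; split; [exact ha | ].
    apply Rnot_lt_le; intros Ha1.
    specialize (H (1 / 2) (Rle_refl _)).
    rewrite (log_concave_on_exp _ (log_marcum (1 / 2) a)) in H
      by (intros t Ht; apply marcum_integrand_exp; lra).
    (* The midpoint inequality with [d = m / 2]; at [m = 0] it would read
       [2 * a^2 <= 2]. *)
    set (psi := fun m : R => cosh (2 * (a * m)) + 1 - 2 * a ^ 2 * (1 - (m / 2) ^ 2)).
    assert (Hc : continuous psi 0).
    { apply (ex_derive_continuous psi 0); unfold psi, cosh; auto_derive; exact I. }
    assert (H0 : psi 0 < 0).
    { unfold psi; rewrite !Rmult_0_r, cosh_0; nra. }
    destruct (Hc _ (open_lt 0 (psi 0) H0)) as [eps Heps].
    assert (He := cond_pos eps).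
    specialize (Heps (eps / 2)).
    assert (Hneg : psi (eps / 2) < 0).
    { apply Heps; change (Rabs (eps / 2 - 0) < eps).
      rewrite Rminus_0_r, Rabs_pos_eq; lra. }
    pose proof (log_marcum_half_midpoint a (eps / 2) (eps / 2 / 2)
      ltac:(lra) ltac:(lra) H).
    unfold psi in Hneg; lra.
  - intros Ha nu Hnu.
    apply (log_concave_on_exp _ (log_marcum nu a)).
    + intros t Ht; apply marcum_integrand_exp; lra.
    + now apply log_marcum_concave.
Qed.
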